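(* Let $P_{\text{ess}}$ be the essential fractal prime set and $C_{1/3}$ the generalized Cantor set. Under the lexicographic ordering of informational cardinalities, $$I(P_{\text{ess}}) > I(C_{1/3}).$$
   Context: The informational cardinality of $M \subset \mathbb{R}$ is the triple $I(M) = (\alpha(M), \delta(M), \iota(M))$, where: the cardinality indicator is $\alpha(M) = 0$ if $|M| \le \aleph_0$ and $\alpha(M) = 1$ if $|M| > \aleph_0$; $\delta(M) = \dim_H(M)$ is the Hausdorff dimension; and $\iota(M)$ is the information measure, whose values for the two sets considered here are fixed by definition: $\iota(P_{\text{ess}}) = -\zeta(1/2)$, with $\zeta$ the Riemann zeta function, and $\iota(C_{1/3}) = 0$. Lexicographic ordering: writing $I(M) = (I_1(M), I_2(M), I_3(M))$, one has $I(M_1) > I(M_2)$ iff there exists $i \in \{1,2,3\}$ such that $I_j(M_1) = I_j(M_2)$ for all $j < i$ and $I_i(M_1) > I_i(M_2)$. The essential fractal prime set $P_{\text{ess}}$: put $I_0 = [0,1]$. For $n \ge 1$, given $I_{n-1}$ as a union of $2^{n-1}$ disjoint closed intervals of length $4^{-(n-1)}$, divide each of these intervals into four equal closed subintervals of length $4^{-n}$, labeled $0,1,2,3$ from left to right, and retain only the subintervals labeled $1$ and $3$. Let $I_n$ be the union of the retained subintervals at stage $n$. Define $P_{\text{ess}} = \bigcap_{n=1}^\infty I_n$. (The sets $I_n$ in this construction are unrelated to the components $I_j(M)$ of the triple.) The generalized Cantor set $C_{1/3}$: let $r = 1/8$, $f_0(x) = rx$, $f_1(x) = rx + (1-r)$.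 Then $C_{1/3}$ is the unique (nonempty) compact set satisfying $C_{1/3} = f_0(C_{1/3}) \cup f_1(C_{1/3})$. *)

(* Defs.v *)
From HB Require Import structures.
From mathcomp Require Import all_boot all_order all_algebra.
From mathcomp Require Import complex.
From mathcomp Require Import all_classical all_reals all_analysis.
From mathcomp Require Import lra.

Set Implicit Arguments.
Unset Strict Implicit.
Unset Printing Implicit Defensive.
Import Order.TTheory GRing.Theory Num.Theory.
Import numFieldNormedType.Exports.
Local Open Scope classical_set_scope.
Local Open Scope ring_scope.
Local Open Scope complex_scope.

Section HausdorffDimension.
Context {R : realType}.
Implicit Types (A U : set R) (s : R).

(* The supremum over the empty set is -oo, so this is only a diameter when
   [A] is nonempty; [diam_pow] treats the empty set apart. *)
Definition ediam A : \bar R :=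
  ereal_sup [set `|p.1 - p.2|%:E | p in A `*` A].

(* The usual convention diam(U)^0 = 1 for nonempty U, and 0 for U empty. *)
Definition diam_pow s A : \bar R :=
  if A == set0 then 0%E else poweR (ediam A) s.

Definition is_delta_cover (delta : R) A (U : nat -> set R) : Prop :=
  A `<=` \bigcup_k U k /\ forall k, (ediam (U k) <= delta%:E)%E.

Definition hausdorff_premeasure s (delta : R) A : \bar R :=
  ereal_inf [set (\sum_(0 <= k <oo) diam_pow s (U k))%E
            | U in is_delta_cover delta A].

Definition hausdorff_measure s A : \bar R :=
  ereal_sup [set hausdorff_premeasure s delta A | delta in [set d : R | 0 < d]].

Definition hausdorff_dim A : \bar R :=
  ereal_inf [set s%:E | s in [set s : R | 0 <= s /\ hausdorff_measure s A = 0%E]].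

End HausdorffDimension.

Section RiemannZeta.
Context {R : realType}.

Definition cexp (z : R[i]) : R[i] :=
  (expR (complex.Re z))%:C * (cos (complex.Im z) +i* sin (complex.Im z)).

(* [n ^ (-s) = exp (- s ln n)], for [n > 0] *)
Definition dirichlet_term (s : R[i]) (n : nat) : R[i] :=
  cexp (- s * (ln n%:R)%:C).

(* R[i]^o is R[i] as a normed module over itself, so [derivable f s 1] is complex
   differentiability of [f] at [s]. *)
Definition is_riemann_zeta (f : R[i] -> R[i]) : Prop :=
  (forall s : R[i], 1 < complex.Re s ->
     series (fun n => dirichlet_term s n.+1) @ \oo --> (f s : R[i]^o)) /\
  (forall s : R[i], s != 1 -> derivable (f : R[i]^o -> R[i]^o) s 1).

(* The analytic continuation is unique on the complement of 1, by the identity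
   theorem; its value at the pole is unspecified. The values at real arguments are real,
   so there [complex.Re (riemann_zeta s)] is the zeta function valued in R. *)
Definition riemann_zeta : R[i] -> R[i] := xget (fun=> 0) is_riemann_zeta.

End RiemannZeta.

Section Sets.
Context {R : realType}.

(* A pair [J] stands for the closed interval [J.1, J.2]; this is its closed
   quarter labelled [j]. *)
Definition quarter (J : R * R) (j : nat) : R * R :=
  (J.1 + (J.2 - J.1) * (j%:R / 4), J.1 + (J.2 - J.1) * (j.+1%:R / 4)).

Fixpoint ess_intervals (n : nat) : seq (R * R) :=
  if n is m.+1 then
    flatten [seq [:: quarter J 1; quarter J 3] | J <- ess_intervals m]
  else [:: (0, 1)].

Definition ess_stage (n : nat) : set R :=
  \bigcup_(J in [set` ess_intervals n]) `[J.1, J.2]%classic.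

Definition P_ess : set R := \bigcap_(n in [set n | (1 <= n)%N]) ess_stage n.

(* The index 1/3 of C_{1/3} is ln 2 / ln 8; the contraction ratio is 1/8. *)
Definition cantor_f0 (x : R) : R := 8^-1 * x.
Definition cantor_f1 (x : R) : R := 8^-1 * x + (1 - 8^-1).

Definition is_C13 (K : set R) : Prop :=
  [/\ compact K, K !=set0 & K = cantor_f0 @` K `|` cantor_f1 @` K].

Definition C13 : set R := xget set0 is_C13.

End Sets.

(* [C13P] and [C13_unique]: the default value of [xget] plays no role in [C13].
   [P_ess_neq_C13]: the values prescribed for the information measure at the
   two sets are compatible. *)
Section CantorExistsUnique.
Context {R : realType}.
Implicit Types (K : set R) (x y : R).

Local Notation F K := (cantor_f0 @` K `|` cantor_f1 @` K).

Let stage n : set R := iter n (fun K => F K) `[0, 1]%classic.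

Let f0_cont : continuous (@cantor_f0 R).
Proof. by move=> x; apply: cvgM; [exact: cvg_cst|exact: cvg_id]. Qed.

Let f1_cont : continuous (@cantor_f1 R).
Proof. by move=> x; apply: cvgD; [exact: f0_cont|exact: cvg_cst]. Qed.

Let F_mono K L : K `<=` L -> F K `<=` F L.
Proof. by move=> KL x [] [y /KL Ly <-]; [left|right]; exists y. Qed.

Let F_compact K : compact K -> compact (F K).
Proof.
move=> cK; apply: compactU; apply: continuous_compact => //;
  apply: continuous_subspaceT; [exact: f0_cont|exact: f1_cont].
Qed.

Let stage_compact n : compact (stage n).
Proof. by elim: n => [|n IH]; [exact: segment_compact|exact: F_compact]. Qed.

Let stage0 n : stage n 0.
Proof.
elim: n => [|n IH]; first by rewrite /stage /= in_itv /= lexx ler01.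
by left; exists 0 => //; rewrite /cantor_f0 mulr0.
Qed.

Let stage01 n : stage n `<=` `[0, 1]%classic.
Proof.
elim: n => [//|n IH] x [] [y /IH /=];
  rewrite in_itv /= /cantor_f0 /cantor_f1 => y01 <-; rewrite in_itv /=; lra.
Qed.

Let stageS n : stage n.+1 `<=` stage n.
Proof. by elim: n => [|n IH]; [exact: (@stage01 1)|exact: F_mono]. Qed.

Let stage_close n x K : K !=set0 -> K = F K -> K `<=` `[0, 1]%classic ->
  stage n x -> exists2 k, K k & `|x - k| <= 8^-1 ^+ n.
Proof.
move=> K0 KF K01; elim: n x => [|n IH] x.
  case: K0 => k Kk x01; exists k => //.
  move: x01 (K01 _ Kk); rewrite /stage /= !in_itv /= => x01 k01.
  rewrite expr0 ler_norml; lra.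
have FK k : F K k -> K k by rewrite -KF.
move=> [] [z /IH[k Kk zk] <-]; [exists (cantor_f0 k)|exists (cantor_f1 k)].
- by apply: FK; left; exists k.
- rewrite /cantor_f0 -mulrBr normrM ger0_norm ?invr_ge0// exprS.
  by rewrite ler_wpM2l ?invr_ge0.
- by apply: FK; right; exists k.
- rewrite /cantor_f1 opprD addrACA subrr addr0 -mulrBr normrM.
  by rewrite ger0_norm ?invr_ge0// exprS ler_wpM2l ?invr_ge0.
Qed.

Let f_inv0 y n : stage n.+1 (cantor_f0 y) -> y <= 1 -> stage n y.
Proof.
move=> [] [z hz] zy y1; last first.
  move: (stage01 hz) zy => /=; rewrite in_itv /= /cantor_f0 /cantor_f1; lra.
by have -> : y = z by move: zy; rewrite /cantor_f0; lra.
Qed.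

Let f_inv1 y n : stage n.+1 (cantor_f1 y) -> 0 <= y -> stage n y.
Proof.
move=> [] [z hz] zy y1.
  move: (stage01 hz) zy => /=; rewrite in_itv /= /cantor_f0 /cantor_f1; lra.
by have -> : y = z by move: zy; rewrite /cantor_f1; lra.
Qed.

Lemma C13_exists : exists K : set R, is_C13 K.
Proof.
have capc : compact (\bigcap_n stage n).
  apply: (@subclosed_compact R _ (`[0, 1]%classic : set R)).
  - apply: closed_bigI => n _.
    exact: (compact_closed (@Rhausdorff R) (@stage_compact n)).
  - exact: segment_compact.
  - by move=> x /(_ 0%N I).
exists (\bigcap_n stage n); split=> //; first by exists 0 => n _.
rewrite eqEsubset; split => x.
  move=> hx; have [] := hx 1%N I => -[y y01 yx]; [left|right];
    exists y => // n _; move: (y01); rewrite /stage /= in_itv /= => /andP[y0 y1].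
  - by apply: f_inv0 => //; rewrite yx; exact: hx.
  - by apply: f_inv1 => //; rewrite yx; exact: hx.
case=> -[y hy yx] n _; apply: (@stageS n); rewrite -yx;
  [left|right]; exists y => //; exact: hy.
Qed.

Let C13_sub01 K : is_C13 K -> K `<=` `[0, 1]%classic.
Proof.
move=> [cK K0 KF]; have FK k : K k -> F K k by rewrite -KF.
have [a aK amin] := @compact_EVT_min _ _ (id : R -> R) K K0 cK
  (continuous_subspaceT (fun x => cvg_id)).
have [b bK bmax] := @compact_EVT_max _ _ (id : R -> R) K K0 cK
  (continuous_subspaceT (fun x => cvg_id)).
rewrite !inE in aK bK; have ge_a t : K t -> a <= t by move=> Kt; apply: amin; rewrite inE.
have le_b t : K t -> t <= b by move=> Kt; apply: bmax; rewrite inE.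
have a0 : 0 <= a.
  by case: (FK _ aK) => -[t /ge_a]; rewrite /cantor_f0 /cantor_f1; lra.
have b1 : b <= 1.
  case: (FK _ bK) => -[t Kt]; move: (le_b _ Kt) (ge_a _ Kt);
    rewrite /cantor_f0 /cantor_f1; lra.
move=> x Kx /=; rewrite in_itv /=; move: (ge_a _ Kx) (le_b _ Kx); lra.
Qed.

Let C13_stage K : is_C13 K -> K = \bigcap_n stage n.
Proof.
move=> CK; have K01 := C13_sub01 CK; case: CK => cK K0 KF.
rewrite eqEsubset; split => x.
  move=> Kx n _; elim: n x Kx => [|n IH] x Kx; first exact: K01.
  by rewrite KF in Kx; exact: F_mono Kx.
move=> hx; have : closed K by exact: (compact_closed (@Rhausdorff R)).
move=> /closure_id -> B /nbhs_ballP[e /= e0 eB].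
have [n ne] : exists n, (8^-1 : R) ^+ n < e.
  have /cvgrPdist_lt /(_ e e0) [n _ /(_ n (leqnn n))] :
      (fun n => (8^-1 : R) ^+ n) @ \oo --> (0 : R).
    by apply: cvg_expr; rewrite ger0_norm; lra.
  by rewrite /= sub0r normrN ger0_norm ?exprn_ge0 ?invr_ge0// => ?; exists n.
have [k Kk xk] := stage_close K0 KF K01 (hx n I).
by exists k; split => //; apply: eB; exact: le_lt_trans ne.
Qed.

Lemma C13_unique (K L : set R) : is_C13 K -> is_C13 L -> K = L.
Proof. by move=> /C13_stage -> /C13_stage ->. Qed.

Lemma C13P : is_C13 (@C13 R).
Proof. by have [K CK] := C13_exists; exact: (xgetPex set0 (ex_intro _ K CK)). Qed.

Lemma P_ess_neq_C13 : P_ess <> @C13 R.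
Proof.
have C0 : @C13 R 0 by rewrite (C13_stage C13P) => n _; exact: stage0.
move=> PC; move: C0; rewrite -PC => /(_ 1%N (leqnn 1))[J].
rewrite /= !in_cons in_nil orbF => /orP[] /eqP -> /=; rewrite in_itv /=; lra.
Qed.

End CantorExistsUnique.

Section InformationalCardinality.
Context {R : realType}.

Definition cardinality_indicator (M : set R) : R :=
  if `[< countable M >] then 0 else 1.

Definition informational_cardinality (iota : set R -> R) (M : set R) :
    3.-tuple (\bar R) :=
  [tuple (cardinality_indicator M)%:E; hausdorff_dim M; (iota M)%:E].

Definition lex_gt (a b : 3.-tuple (\bar R)) : Prop :=
  exists i : 'I_3,
    (forall j : 'I_3, (j < i)%N -> tnth a j = tnth b j) /\
    (tnth b i < tnth a i)%E.

End InformationalCardinality.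

(* Main.v *)
Require Import Defs.
From mathcomp Require Import all_boot all_order all_algebra.
From mathcomp Require Import complex.
From mathcomp Require Import all_classical all_reals all_analysis.
From mathcomp Require Import lra.

(** [P_ess] is uncountable and [dim C13 <= 1/3 < 1/2 <= dim P_ess]. If [C13]
were countable, the cardinality indicator would decide; otherwise the
indicators agree and the Hausdorff dimension decides.

The bound on [dim C13] comes from its own equation: applying it [n] times
covers [C13] by [2 ^ n] copies of itself scaled by [8 ^- n], and the sum of
the [s]-th powers of their diameters is a constant times [(2 * 8 ^- s) ^ n],
which tends to 0 as soon as [s > 1/3]
([hausdorff_measure_self_covered_eq0]).

Instead of constructing a mass distribution on [P_ess], the lower bound pulls
covers back to the half-open unit interval. Reading the binary digits [b] of a
number [t] there as the base 4 digits [2 * b + 1] gives a map [h] into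
[P_ess]. If [t] and [u] first separate at stage [n], then [`|t - u|] is at
most [2 * 2 ^- n], while [h t] and [h u] lie in quarters 1 and 3 of a common
cell, hence at distance at least [4 ^- n], the length of quarter 2. So
[`|t - u| <= 2 * `|h t - h u| `^ (1/2)] ([P_ess_expanding]). A cover of
[P_ess] by sets [U k] therefore induces a cover of the unit interval by
intervals of length at most [4 * diam (U k) `^ (1/2)], and countable
subadditivity of the Lebesgue measure keeps the sum of the
[diam (U k) `^ (1/2)] away from 0 ([hausdorff_dim_ge_of_expanding]). The same
inequality makes [h] injective, whence uncountability
([uncountable_of_expanding]). *)

Set Implicit Arguments.
Unset Strict Implicit.
Unset Printing Implicit Defensive.
Import Order.TTheory GRing.Theory Num.Theory.
Import numFieldNormedType.Exports.
Local Open Scope classical_set_scope.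
Local Open Scope ring_scope.

(** * Diameters of subsets of the line *)

Section Diameter.
Context {R : realType}.
Implicit Types (A U : set R) (d s : R).

Lemma ediam_leP A d :
  (ediam A <= d%:E)%E <-> (forall x y, A x -> A y -> `|x - y| <= d).
Proof.
split=> [Ad x y Ax Ay|Ad]; last first.
  by apply: ge_ereal_sup => _ [[x y] [/= Ax Ay] <-]; rewrite lee_fin Ad.
rewrite -lee_fin; apply: le_trans Ad; apply: ereal_sup_ubound.
by exists (x, y).
Qed.

Lemma ediam_ge0 A : A !=set0 -> (0 <= ediam A)%E.
Proof.
move=> [x Ax]; apply: ereal_sup_ubound; exists (x, x) => //=.
by rewrite subrr normr0.
Qed.

Lemma diam_pow_ge0 s A : (0 <= diam_pow s A)%E.
Proof. by rewrite /diam_pow; case: ifP => // _; exact: poweR_ge0. Qed.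

Lemma diam_pow_le s d A : 0 <= s -> 0 <= d -> (ediam A <= d%:E)%E ->
  (diam_pow s A <= (d `^ s)%:E)%E.
Proof.
move=> s0 d0 Ad; rewrite /diam_pow; case: ifP => [_|/negbT /set0P A0].
  by rewrite lee_fin powR_ge0.
rewrite -poweR_EFin gt0_ler_poweR// in_itv /= leey andbT ?ediam_ge0//.
Qed.

Lemma ediam0_le d : (ediam (set0 : set R) <= d%:E)%E.
Proof. by apply/ediam_leP. Qed.

End Diameter.

(** * Upper bounds by finite covers *)

Section UpperBound.
Context {R : realType}.
Implicit Types (A K : set R) (d s : R).

(** A single bound [e] on both the mesh and the total suffices: asking for
[e] below the given mesh [delta] makes the cover admissible for it. *)
Lemma hausdorff_measure_eq0 s A : 0 <= s ->
  (forall e, 0 < e -> exists N d (V : nat -> set R),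
    [/\ 0 <= d <= e, N%:R * d `^ s <= e,
        A `<=` \bigcup_(k in `I_N) V k &
        forall k, (ediam (V k) <= d%:E)%E]) ->
  hausdorff_measure s A = 0%E.
Proof.
move=> s0 cov.
have pre0 delta : 0 < delta -> hausdorff_premeasure s delta A = 0%E.
  move=> delta0; apply/eqP; rewrite eq_le; apply/andP; split; last first.
    apply: le_ereal_inf_tmp => _ [U _ <-].
    by apply: nneseries_ge0 => k _ _; exact: diam_pow_ge0.
  apply/lee_addgt0Pr => e e0; rewrite add0e.
  have [|N [d [V [/andP[d0 de] Ne AV Vd]]]] := cov (Num.min delta e).
    by rewrite lt_min delta0.
  move: de Ne; rewrite !le_min => /andP[ddelta _] /andP[_ Ne].
  apply: (@ge_ereal_inf _ _ e%:E).
  pose U k := if (k < N)%N then V k else set0.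
  exists (\sum_(0 <= k <oo) diam_pow s (U k))%E.
    exists U => //; split=> [x /AV[k /= kN Vx]|k].
      by exists k => //; rewrite /U kN.
    rewrite /U; case: ifP => _; last exact: ediam0_le.
    by apply: le_trans (Vd k) _; rewrite lee_fin.
  apply: lime_le.
    by apply: is_cvg_nneseries => k _ _; exact: diam_pow_ge0.
  apply: nearW => n.
  (* The empty sets past the index N contribute 0, so every partial sum has at
     most N nonzero terms, each bounded by d `^ s. *)
  apply: (@le_trans _ _ (\sum_(0 <= k < n | (k < N)%N) (d `^ s)%:E)%E).
    rewrite [leRHS]big_mkcond /=; apply: lee_sum => k _; rewrite /U.
    case: ifP => _; first exact: diam_pow_le.
    by rewrite /diam_pow eqxx.
  apply: (@le_trans _ _ (\sum_(0 <= k < N) (d `^ s)%:E)%E); last first.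
    by rewrite sumEFin sumr_const_nat subn0 lee_fin -mulr_natl.
  rewrite !sumEFin lee_fin -!(big_filter _ (fun k => (k < N)%N)).
  rewrite big_const_seq sumr_const_nat subn0 iter_addr_0 count_predT.
  rewrite ler_wpMn2l ?powR_ge0//.
  rewrite -[leqRHS](size_iota 0).
  apply: uniq_leq_size; first by rewrite filter_uniq// iota_uniq.
  by move=> k; rewrite mem_filter mem_iota add0n => /andP[].
apply/eqP; rewrite eq_le; apply/andP; split.
  by apply: ge_ereal_sup => _ [delta /= delta0 <-]; rewrite pre0.
by apply: ereal_sup_ubound; exists 1 => //=; rewrite ?ltr01// pre0.
Qed.

(** Each inclusion of [K] in [f0 @` K `|` f1 @` K] doubles the number of
pieces and multiplies their size by [r]. The pieces at depth [n] are indexed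
by binary words read as integers below [2 ^ n]: the last bit selects the
outermost map. *)
Lemma iterated_cover K f0 f1 (D r : R) n : 0 <= r ->
  K `<=` f0 @` K `|` f1 @` K ->
  (forall x y, `|f0 x - f0 y| <= r * `|x - y|) ->
  (forall x y, `|f1 x - f1 y| <= r * `|x - y|) ->
  (ediam K <= D%:E)%E ->
  exists V : nat -> set R, K `<=` \bigcup_(k in `I_(2 ^ n)) V k /\
    forall k, (ediam (V k) <= (r ^+ n * D)%:E)%E.
Proof.
move=> r0 Kf f0r f1r KD; elim: n => [|n [V [KV VD]]].
  exists (fun=> K); split; last by move=> k; rewrite expr0 mul1r.
  by move=> x Kx; exists 0%N.
pose f k := if odd k then f1 else f0.
exists (fun k => f k @` V k./2); split=> [x /Kf|k].
  case=> -[y /KV[k /= kn Vy] <-].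
    exists k.*2; rewrite /= ?expnS ?mul2n ?ltn_double//.
    by exists y => //; rewrite ?doubleK// /f odd_double.
  exists k.*2.+1; rewrite /= ?expnS ?mul2n ?ltn_Sdouble//.
  by exists y; rewrite ?uphalf_double// /f /= odd_double.
apply/ediam_leP => _ _ [x Vx <-] [y Vy <-].
have /ediam_leP /(_ _ _ Vx Vy) xyD := VD k./2.
apply: (@le_trans _ _ (r * `|x - y|)); first by rewrite /f; case: ifP.
by rewrite exprS -mulrA ler_wpM2l.
Qed.

(** The [2 ^ n] pieces of depth [n] have diameter at most [r ^+ n * D], so
they contribute [(2 * r `^ s) ^+ n * D `^ s], a vanishing geometric
sequence. *)
Lemma hausdorff_measure_self_covered_eq0 K f0 f1 r s :
  0 <= r < 1 -> 0 <= s -> 2 * r `^ s < 1 -> bounded_set K ->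
  K `<=` f0 @` K `|` f1 @` K ->
  (forall x y, `|f0 x - f0 y| <= r * `|x - y|) ->
  (forall x y, `|f1 x - f1 y| <= r * `|x - y|) ->
  hausdorff_measure s K = 0%E.
Proof.
move=> /andP[r0 r1] s0 rs bK Kf f0r f1r.
apply: hausdorff_measure_eq0 => // e e0.
have [D D0 KD] : exists2 D : R, 0 <= D & (ediam K <= D%:E)%E.
  have [M M0 KM] := ex_strict_bound_gt0 bK.
  exists (M + M); first lra.
  apply/ediam_leP => x y Kx Ky; rewrite (le_trans (ler_normB _ _))//.
  by rewrite lerD// ltW// KM.
have small (q C : R) : 0 <= q < 1 -> 0 <= C ->
    \forall n \near \oo, q ^+ n * C <= e.
  move=> /andP[q0 q1] C0.
  have /cvgrPdist_le /(_ e e0) : (fun n => q ^+ n * C) @ \oo --> 0 * C.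
    by apply: cvgMl; apply: cvg_expr; rewrite ger0_norm.
  apply: filterS => n; rewrite mul0r sub0r normrN ger0_norm//.
  by rewrite mulr_ge0// exprn_ge0.
have [n _ /(_ n (leqnn n)) [ne1 ne2]] : \forall n \near \oo,
    r ^+ n * D <= e /\ (2 * r `^ s) ^+ n * D `^ s <= e.
  apply: filterI; apply: small => //; rewrite ?r0 ?powR_ge0// rs andbT.
  by rewrite mulr_ge0// powR_ge0.
have [V [KV VD]] := iterated_cover n r0 Kf f0r f1r KD.
exists (2 ^ n)%N, (r ^+ n * D), V; split=> //.
  by rewrite ne1 mulr_ge0// exprn_ge0.
rewrite powRM ?exprn_ge0// mulrA natrX (_ : (r ^+ n) `^ s = (r `^ s) ^+ n).
  by rewrite -exprMn.
by rewrite -!powR_mulrn ?powR_ge0// -!powRrM mulrC.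
Qed.

(** The critical exponent solves [2 * 8^-1 `^ s = 1], that is [s = 1/3]. *)
Lemma hausdorff_dim_C13_le : (hausdorff_dim (@C13 R) <= (3^-1)%:E)%E.
Proof.
have [cK _ KF] := @C13P R.
apply/lee_addgt0Pr => e e0; apply: ereal_inf_lbound.
exists (3^-1 + e) => //; split; first by lra.
apply: (@hausdorff_measure_self_covered_eq0 _ cantor_f0 cantor_f1 8^-1).
- by lra.
- by lra.
- rewrite powRD; last by apply/implyP => /eqP; lra.
  (* 2 * 8^-1 `^ (3^-1 + e) = 8^-1 `^ e < 1 *)
  have -> : (8^-1 : R) = (2^-1) `^ 3%:R by rewrite powR_mulrn; lra.
  rewrite -2!powRrM divff ?pnatr_eq0// powRr1; last by lra.
  rewrite mulrA divff ?pnatr_eq0// mul1r powRrM.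
  have : (2^-1 `^ 3%:R) `^ e < 1 `^ e :> R.
    by apply: gt0_ltr_powR; rewrite ?nnegrE ?powR_ge0// powR_mulrn; lra.
  by rewrite powR1.
- exact: compact_bounded.
- by rewrite {1}KF.
- by move=> x y; rewrite /cantor_f0 -mulrBr normrM ger0_norm.
- move=> x y; rewrite /cantor_f1 opprD addrACA subrr addr0 -mulrBr normrM.
  by rewrite ger0_norm.
Qed.

End UpperBound.

(** * Lower bounds by expanding maps from the unit interval *)

Section LowerBound.
Context {R : realType}.
Implicit Types (A U : set R) (h : R -> R) (c s t u : R).

(** If [h t0] lies in [U], every [t] with [h t] in [U] is within
[c * diam U `^ s] of [t0]; as [diam U <= 1], lowering the exponent to [s']
only increases the bound. The closed interval stands in for the preimage
itself, which need not be measurable. *)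
Lemma expanding_preimage_measure h c s s' U : 0 <= s' < s -> 0 < c ->
  {in `[0, 1[ &, forall t u, `|t - u| <= c * `|h t - h u| `^ s} ->
  (ediam U <= 1%:E)%E ->
  exists B : set R, [/\ measurable B,
    forall t, t \in `[0, 1[ -> U (h t) -> B t &
    (lebesgue_measure B <= (2 * c)%:E * diam_pow s' U)%E].
Proof.
move=> /andP[s'0 s's] c0 hexp U1.
have [[t0 t01 Ut0]|nU] := pselect (exists2 t, t \in `[0, 1[ & U (h t));
    last first.
  exists set0; split=> [|t t01 Ut|]; first exact: measurable0.
    by apply: nU; exists t.
  by rewrite measure0 mule_ge0 ?diam_pow_ge0// lee_fin; lra.
have U0 : U !=set0 by exists (h t0).
have := ediam_ge0 U0; case ed : (ediam U) U1 => [d| |]//.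
rewrite !lee_fin => d1 d0.
have /ediam_leP dU : (ediam U <= d%:E)%E by rewrite ed.
pose r := c * d `^ s.
have r0 : 0 <= r by rewrite mulr_ge0 ?powR_ge0// ltW.
exists `[t0 - r, t0 + r]%classic; split=> [|t t01' Ut|].
- exact: measurable_itv.
- rewrite /= in_itv /= -ler_distlC distrC.
  apply: le_trans (hexp _ _ t01' t01) _; rewrite ler_wpM2l ?(ltW c0)//.
  by rewrite ge0_ler_powR ?nnegrE ?dU//; lra.
- rewrite lebesgue_measure_itv /= lte_fin.
  have dd : d `^ s <= d `^ s'.
    have [->|dn0] := eqVneq d 0; first by rewrite powR0 ?powR_ge0//; lra.
    by apply: (ger_powR _ (ltW s's)); rewrite d1 lt_neqAle eq_sym dn0 d0.
  rewrite /diam_pow; have /set0P/negbTE -> := U0.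
  rewrite ed poweR_EFin -EFinM.
  have : 2 * r <= 2 * c * d `^ s' by rewrite /r mulrA ler_wpM2l//; lra.
  case: ifP => _; rewrite -?EFinB lee_fin.
    by apply: le_trans; lra.
  by apply: le_trans; lra.
Qed.

(** A dimension below [s] would provide a cover of [A] whose total for some
exponent [s' < s] is below [(2 * c)^-1]; the induced intervals would then
cover the unit interval with total length below 1. *)
Lemma hausdorff_dim_ge_of_expanding A h c s : 0 < c ->
  {in `[0, 1[, forall t, A (h t)} ->
  {in `[0, 1[ &, forall t u, `|t - u| <= c * `|h t - h u| `^ s} ->
  (s%:E <= hausdorff_dim A)%E.
Proof.
move=> c0 hA hexp; apply: le_ereal_inf_tmp => _ [s' [s'0 As'] <-].
rewrite lee_fin leNgt; apply/negP => s's.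
have : (hausdorff_premeasure s' 1 A < ((2 * c)^-1)%:E)%E.
  apply: (@le_lt_trans _ _ 0%E); last by rewrite lte_fin invr_gt0; lra.
  by rewrite -As'; apply: ereal_sup_ubound; exists 1 => /=.
move=> /ereal_inf_lt[_ [U [AU U1] <-]] Usmall.
have /choice[B BP] k : exists B : set R, [/\ measurable B,
    forall t, t \in `[0, 1[ -> U k (h t) -> B t &
    (lebesgue_measure B <= (2 * c)%:E * diam_pow s' (U k))%E].
  by apply: expanding_preimage_measure hexp (U1 k); rewrite ?s'0.
have : (lebesgue_measure (`[0%R, 1%R[%classic : set R)
    <= \sum_(0 <= k <oo) lebesgue_measure (B k))%E.
  apply: measure_sigma_subadditive => [k||t t01].
  - by case: (BP k).
  - exact: measurable_itv.
  - have [k _ Ut] := AU _ (hA t t01).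
    by exists k => //; have [_ + _] := BP k; apply.
rewrite lebesgue_measure_itv /= lte_fin ltr01 -EFinB subr0.
apply/negP; rewrite -ltNge.
apply: (@le_lt_trans _ _ (\sum_(0 <= k <oo) (2 * c)%:E * diam_pow s' (U k))%E).
  by apply: lee_nneseries => k *; [exact: measure_ge0|case: (BP k)].
rewrite nneseriesZl; last by move=> k _; exact: diam_pow_ge0.
rewrite -lte_pdivlMl; last by lra.
by rewrite mule1.
Qed.

(** [h] is injective on the unit interval, which is uncountable because its
Lebesgue measure is not 0. *)
Lemma uncountable_of_expanding A h c s : s != 0 ->
  {in `[0, 1[, forall t, A (h t)} ->
  {in `[0, 1[ &, forall t u, `|t - u| <= c * `|h t - h u| `^ s} ->
  ~ countable A.
Proof.
move=> s0 hA hexp /pcard_injP[j jinj].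
have : lebesgue_measure (`[0%R, 1%R[%classic : set R) = 0%E.
  apply: countable_lebesgue_measure0; apply/pcard_injP; exists (j \o h).
  move=> t u; rewrite !inE => t01 u01 /= jtu.
  have htu : h t = h u by apply: jinj; rewrite ?inE//; exact: hA.
  have := hexp t u t01 u01; rewrite htu subrr normr0 powR0// mulr0 normr_le0.
  by rewrite subr_eq0 => /eqP.
rewrite lebesgue_measure_itv /= lte_fin ltr01 -EFinB subr0 => /eqP.
by rewrite eqe oner_eq0.
Qed.

End LowerBound.

(** * Binary addresses in the essential prime set *)

Section EssentialSet.
Context {R : realType}.
Implicit Types (t u x y : R) (KJ : (R * R) * (R * R)).

(** Each step chooses the half of a dyadic interval [KJ.1] that contains [t],
and the quarter of a cell [KJ.2] of the construction of [P_ess] that encodes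
this binary digit: 0 becomes label 1 and 1 becomes label 3. *)
Definition bisect t KJ :=
  let m := (KJ.1.1 + KJ.1.2) / 2 in
  if t < m then ((KJ.1.1, m), quarter KJ.2 1)
  else ((m, KJ.1.2), quarter KJ.2 3).

Definition address t n := iter n (bisect t) ((0, 1), (0, 1)).

Local Notation dyadic t n := (address t n).1.
Local Notation cell t n := (address t n).2.

Lemma dyadic_mem t n : t \in `[0, 1[ -> (dyadic t n).1 <= t < (dyadic t n).2.
Proof.
rewrite in_itv /= => t01; elim: n => //= n.
rewrite /bisect; case: ifP => /= [|/negbT]; lra.
Qed.

Lemma dyadic_length t n : (dyadic t n).2 - (dyadic t n).1 = 2^-1 ^+ n.
Proof.
elim: n => [|n IH] /=; first by rewrite subr0 expr0.
by rewrite exprS -IH /bisect; case: ifP => _ /=; lra.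
Qed.

(** Halving on one side and quartering on the other preserve this relation; it
is where the exponent 1/2 comes from. *)
Lemma cell_length t n :
  (cell t n).2 - (cell t n).1 = ((dyadic t n).2 - (dyadic t n).1) ^+ 2.
Proof.
elim: n => [|n IH] /=; first by rewrite subr0 expr1n.
rewrite /bisect; case: ifP => _ /=; rewrite IH expr2; lra.
Qed.

Lemma cell_ess_intervals t n : cell t n \in ess_intervals n.
Proof.
elim: n => [|n IH]; first by rewrite mem_seq1.
apply/flattenP; exists [:: quarter (cell t n) 1; quarter (cell t n) 3].
  by apply/mapP; exists (cell t n).
by rewrite /= /bisect !inE; case: ifP => _ /=; rewrite eqxx ?orbT.
Qed.

Lemma cellS t n : (cell t n).1 <= (cell t n.+1).1 /\
  (cell t n.+1).2 <= (cell t n).2.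
Proof.
have := sqr_ge0 ((dyadic t n).2 - (dyadic t n).1).
by rewrite -cell_length /= /bisect; case: ifP => _ /=; lra.
Qed.

Lemma nested_cells_point t :
  exists x, forall n, (cell t n).1 <= x <= (cell t n).2.
Proof.
have up m k : (cell t m).1 <= (cell t (m + k)).1.
  elim: k => [|k /le_trans]; first by rewrite addn0.
  by rewrite addnS; apply; case: (cellS t (m + k)).
have dn m k : (cell t (m + k)).2 <= (cell t m).2.
  elim: k => [|k]; first by rewrite addn0.
  by apply: le_trans; rewrite addnS; case: (cellS t (m + k)).
have lt12 m n : (cell t m).1 <= (cell t n).2.
  apply: le_trans (up m n) _; apply: le_trans (dn n m); rewrite addnC.
  by rewrite -subr_ge0 cell_length sqr_ge0.
have hub n : ubound (range (fun m => (cell t m).1)) (cell t n).2.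
  by move=> _ [m _ <-].
exists (sup (range (fun m => (cell t m).1))) => n; apply/andP; split.
  apply: sup_upper_bound; last by exists n.
  by split; [exists (cell t 0).1; exists 0%N|exists (cell t 0).2].
by apply: ge_sup => //; exists (cell t 0).1; exists 0%N.
Qed.

(** As long as the addresses of [t] and [u] agree, both numbers lie in a common
dyadic interval [K] and their images in a common cell [J]. At the first
disagreement, the images are in quarters 1 and 3 of [J], hence at distance at
least a quarter of the length of [J], which is the square of that of [K]. *)
Lemma cell_separation t u x y : t \in `[0, 1[ -> u \in `[0, 1[ ->
  (forall n, (cell t n).1 <= x <= (cell t n).2) ->
  (forall n, (cell u n).1 <= y <= (cell u n).2) ->
  (t - u) ^+ 2 <= 4 * `|x - y|.
Proof.
move=> t01 u01 xt yu.
have step n : address t n = address u n \/ (t - u) ^+ 2 <= 4 * `|x - y|.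
  elim: n => [|n [tun|]]; [by left| |by right].
  have := xt n.+1; have := yu n.+1.
  have := dyadic_mem n t01; have := dyadic_mem n u01.
  have := cell_length u n.
  rewrite /= tun /bisect; set K := dyadic u n; set J := cell u n => JK uK tK.
  have tuJ : (t - u) ^+ 2 <= J.2 - J.1.
    by rewrite JK -subr_ge0 subr_sqr mulr_ge0//; lra.
  case: ifP => tm; case: ifP => um /= yJ xJ;
    first [by left | right; apply: (le_trans tuJ)].
    by have := ler_norm (x - y); lra.
  by rewrite distrC; have := ler_norm (y - x); lra.
have [->|tu] := eqVneq t u; first by rewrite subrr expr0n mulr_ge0.
(* Distinct numbers cannot have the same address forever, since the dyadic
   intervals shrink to a point. *)
have tu0 : 0 < `|t - u| by rewrite normr_gt0 subr_eq0.
have [n ntu] : exists n, (2^-1 : R) ^+ n < `|t - u|.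
  have /cvgrPdist_lt /(_ _ tu0) [n _ /(_ n (leqnn n))] :
      (fun n => (2^-1 : R) ^+ n) @ \oo --> (0 : R).
    by apply: cvg_expr; rewrite ger0_norm; lra.
  by rewrite /= sub0r normrN ger0_norm ?exprn_ge0 ?invr_ge0// => ?; exists n.
have [tun|//] := step n; exfalso.
have := dyadic_mem n t01; have := dyadic_mem n u01.
have := dyadic_length u n; rewrite tun => Ln un tn.
suff : `|t - u| <= 2^-1 ^+ n by rewrite leNgt ntu.
by rewrite ler_norml -Ln; lra.
Qed.

Lemma P_ess_expanding : exists h : R -> R,
  {in `[0, 1[, forall t, P_ess (h t)} /\
  {in `[0, 1[ &, forall t u, `|t - u| <= 2 * `|h t - h u| `^ 2^-1}.
Proof.
have [h hcell] := choice nested_cells_point.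
exists h; split=> [t t01 n _|t u t01 u01].
  exists (cell t n); first exact: cell_ess_intervals.
  by rewrite /= in_itv /= hcell.
rewrite powR12_sqrt// -ler_sqr ?nnegrE ?mulr_ge0 ?sqrtr_ge0//.
rewrite real_normK ?num_real// exprMn sqr_sqrtr//.
have := cell_separation t01 u01 (hcell t) (hcell u).
by congr (_ <= _ * _); lra.
Qed.

End EssentialSet.

(** * Comparison of the two sets *)

Lemma hausdorff_dim_C13_lt_P_ess (R : realType) :
  (hausdorff_dim (@C13 R) < hausdorff_dim (@P_ess R))%E.
Proof.
have [h [hP hexp]] := @P_ess_expanding R.
apply: le_lt_trans hausdorff_dim_C13_le _.
apply: (@lt_le_trans _ _ (2^-1)%:E); first by rewrite lte_fin; lra.
by apply: hausdorff_dim_ge_of_expanding hP hexp.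
Qed.

Lemma P_ess_uncountable (R : realType) : ~ countable (@P_ess R).
Proof.
have [h [hP hexp]] := @P_ess_expanding R.
by apply: uncountable_of_expanding hP hexp; rewrite invr_neq0.
Qed.

Theorem theorem5p2 (R : realType) (iota : set R -> R)
    (iota_P_ess : iota P_ess = - complex.Re (riemann_zeta (2^-1 : complex R)))
    (iota_C13 : iota C13 = 0) :
  lex_gt (informational_cardinality iota P_ess)
         (informational_cardinality iota C13).
Proof.
have aP : cardinality_indicator (@P_ess R) = 1.
  by rewrite /cardinality_indicator; case: asboolP => // /P_ess_uncountable.
case: (pselect (countable (@C13 R))) => cC.
  exists ord0; split=> //.
  rewrite !(tnth_nth 0%E) /= aP /cardinality_indicator.
  by case: asboolP => // _; rewrite lte_fin.
exists (lift ord0 ord0); split; last first.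
  by rewrite !(tnth_nth 0%E) /=; exact: hausdorff_dim_C13_lt_P_ess.
move=> j; rewrite ltnS leqn0 => /eqP j0.
have -> : j = ord0 by exact: val_inj.
rewrite !(tnth_nth 0%E) /= aP /cardinality_indicator.
by case: asboolP.
Qed.
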